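(* Let $P_X$ be an $X$-profile where $X=\{x^*\}\cup\{x_1,\dots,x_p\}$ with $p\ge 1$, and let $k\geq 1$ be an integer. Then $x^*$ is a possible cowinner for $P_X$ and the Borda rule with respect to the addition of $k$ new candidates if and only if $$k\;\geq\;\max_{z\in X\setminus\{x^*\}}\frac{S_B(z,P_X)-S_B(x^*,P_X)}{N_{P_X}(x^*,z)},$$ where the quotient is read as $+\infty$ when $N_{P_X}(x^*,z)=0$.
   Context: A vote over a finite candidate set $C$ is a linear order on $C$; a $C$-profile is a list $\langle V_1,\dots,V_n\rangle$ ($n\geq 1$) of votes over $C$. If $X\subseteq C$, a $C$-profile $P'=\langle V_1',\dots,V_n'\rangle$ extends an $X$-profile $P_X=\langle V_1,\dots,V_n\rangle$ if for each $i$ the restriction of $V_i'$ to $X$ is $V_i$. The Borda score $S_B(x,P)$ of $x$ in a profile $P$ over $m$ candidates is the sum over votes of $m-i$, where $i$ is the position of $x$ in the vote (scoring vector $\langle m-1,m-2,\dots,0\rangle$, with $m$ the number of candidates of $P$); the Borda rule $r_B(P)$ is the set of candidates maximizing $S_B(\cdot,P)$. $N_P(x,x')$ is the number of votes in $P$ ranking $x$ above $x'$. A candidate $x^*\in X$ is a possible cowinner for $P_X$ and $r$ with respect to the addition of $k$ new candidates if there is an $(X\cup Y)$-profile $P'$ extending $P_X$ with $x^*\in r(P')$, where $Y=\{y_1,\dots,y_k\}$ is a set of $k$ candidates disjoint from $X$. *)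

(* Defs.v *)
From mathcomp Require Import all_boot all_order all_algebra.
From mathcomp Require Import constructive_ereal.
Set Implicit Arguments.
Unset Strict Implicit.
Unset Printing Implicit Defensive.
Import Order.TTheory GRing.Theory Num.Theory.

(* [V a b] reads "the vote V ranks a at least as high as b". *)
Record vote (C : finType) := Vote {
  vote_rel :> rel C;
  vote_linear : [/\ reflexive vote_rel, antisymmetric vote_rel,
                    transitive vote_rel & total vote_rel] }.

Definition above (C : finType) (V : vote C) : rel C :=
  [rel a b | (a != b) && V a b].

(* Positions are numbered from 1 (the top candidate) to #|C|. *)
Definition position (C : finType) (V : vote C) (x : C) : nat :=
  #|[set y | above V y x]|.+1.

(* The requirement that a profile has at least one vote is left to theorems. *)
Definition profile (C : finType) (n : nat) := n.-tuple (vote C).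

(* The subtraction never truncates, since a position is at most #|C|. *)
Definition borda_score (C : finType) (n : nat) (x : C) (P : profile C n) : nat :=
  \sum_(V <- P) (#|C| - position V x).

Definition voting_rule := forall (C : finType) (n : nat), profile C n -> {set C}.

Definition borda : voting_rule := fun C n P =>
  [set x | [forall y, borda_score y P <= borda_score x P]].

Definition prefers (C : finType) (n : nat) (P : profile C n) (x y : C) : nat :=
  count (fun V : vote C => above V x y) P.

(* The disjoint union of X and Y is the sum type X + Y, with X embedded by inl. *)
Definition extends (X Y : finType) (n : nat)
    (P' : profile (X + Y)%type n) (P : profile X n) : Prop :=
  forall i : 'I_n, [rel a b | tnth P' i (inl a) (inl b)] =2 tnth P i.

(* The k new candidates y_1, ..., y_k are the elements of 'I_k. *)
Definition possible_cowinner (r : voting_rule) (X : finType) (n : nat)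
    (P : profile X n) (x : X) (k : nat) : Prop :=
  exists P' : profile (X + 'I_k)%type n, extends P' P /\ inl x \in r _ _ P'.

(* The score difference is a rational, not a truncated natural, difference. *)
Definition borda_quotient (X : finType) (n : nat) (P : profile X n)
    (x z : X) : \bar rat :=
  if prefers P x z == 0 then +oo%E
  else (((borda_score z P)%:R - (borda_score x P)%:R)
          / (prefers P x z)%:R)%R%:E.

(* Main.v *)
Require Import Defs.
From mathcomp Require Import all_boot all_order all_algebra.
From mathcomp Require Import constructive_ereal.
Set Implicit Arguments.
Unset Strict Implicit.
Unset Printing Implicit Defensive.
Import Order.TTheory GRing.Theory Num.Theory.

(** The Borda score of x is the sum of the pairwise counts N(x, w), and these
    counts satisfy the triangle inequality N(x, y) <= N(x, z) + N(z, y).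
    Applied to each new candidate y, the inequality shows that k new candidates
    can improve x* relative to z by at most k N(x*, z); inserting all of them
    directly below x* in every vote attains this bound for all z at once, and
    keeps x* above every new candidate. *)

Section Vote.
Variables (C : finType) (V : vote C).

Lemma vote_refl : reflexive V. Proof. by case: (vote_linear V). Qed.
Lemma vote_anti : antisymmetric V. Proof. by case: (vote_linear V). Qed.
Lemma vote_trans : transitive V. Proof. by case: (vote_linear V). Qed.
Lemma vote_total : total V. Proof. by case: (vote_linear V). Qed.

Lemma aboveN (x y : C) : above V x y = ~~ V y x.
Proof.
rewrite /above /=; have [->|neq_xy] := eqVneq x y; first by rewrite vote_refl.
case Vyx: (V y x) (vote_total x y) => /=; last by rewrite orbF.
by move=> _; apply/negP=> Vxy; case/eqP: neq_xy; apply: vote_anti; rewrite Vxy.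
Qed.

(** Contrapositive of transitivity: [y] ranked at least as high as [z], and [z] at least as high as
    [x], would put [y] at least as high as [x]. *)
Lemma above_split (x z y : C) : above V x y -> above V x z || above V z y.
Proof.
rewrite !aboveN -negb_and; apply: contra => /andP[Vzx Vyz].
exact: vote_trans Vyz Vzx.
Qed.

Lemma above_neg (x y : C) : x != y -> above V y x = ~~ above V x y.
Proof.
by move=> neq_xy; rewrite (aboveN x) negbK /above /= eq_sym neq_xy.
Qed.

(** The candidates below [x] are the complement of [x] together with those above it, and [position]
    counts the latter set. *)
Lemma position_points (x : C) : #|C| - position V x = \sum_y above V x y.
Proof.
have -> : \sum_y (above V x y : nat) = #|[set y | above V x y]|.
  rewrite -sum1dep_card [RHS]big_mkcond; apply: eq_bigr => y _.
  by case: (above V x y).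
have -> : [set y | above V x y] = ~: (x |: [set y | above V y x]).
  apply/setP=> y; rewrite !inE; have [->|neq_yx] := eqVneq y x.
    by rewrite aboveN vote_refl.
  by rewrite (above_neg neq_yx).
rewrite -(cardsC (x |: [set y | above V y x])) cardsU1 inE aboveN vote_refl.
by rewrite /position add1n addKn.
Qed.

End Vote.

Section Prefers.
Variables (C : finType) (n : nat) (P : profile C n).

Lemma borda_score_prefers (x : C) : borda_score x P = \sum_y prefers P x y.
Proof.
rewrite /borda_score (eq_bigr _ (fun V _ => position_points V x)).
rewrite exchange_big; apply: eq_bigr => y _ /=.
by rewrite /prefers -sum1_count [RHS]big_mkcond; apply: eq_bigr => V _; case: ifP.
Qed.

Lemma prefersE (x y : C) : prefers P x y = \sum_(V <- P) above V x y.
Proof.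
by rewrite /prefers -sum1_count big_mkcond; apply: eq_bigr => V _; case: ifP.
Qed.

Lemma prefers_triangle (z x y : C) :
  prefers P x y <= prefers P x z + prefers P z y.
Proof.
rewrite !prefersE -big_split; apply: leq_sum => V _ /=.
have := @above_split _ V x z y.
by case: (above V x y) (above V x z) (above V z y) => [] [] [] // /(_ isT).
Qed.

Lemma prefersxx (x : C) : prefers P x x = 0.
Proof.
by rewrite prefersE big1 // => V _; rewrite /above /= eqxx.
Qed.

Lemma prefers_swap (x y : C) : x != y -> prefers P x y + prefers P y x = n.
Proof.
move=> neq_xy; rewrite -[RHS](size_tuple P) -(count_predC (fun V => above V x y)).
by congr (_ + _); apply: eq_count => V /=; rewrite above_neg.
Qed.

(** The triangle inequality through [z] bounds each count for [x] by the same count for [z]. This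
    will show that no new candidate beats the designated one. *)
Lemma borda_score_dominated (x z : C) :
  prefers P x z = 0 -> borda_score x P <= borda_score z P.
Proof.
move=> Nxz; rewrite !borda_score_prefers; apply: leq_sum => w _.
by rewrite (leq_trans (prefers_triangle z x w)) // Nxz.
Qed.

(** The opponent [x] makes the inequality strict: it contributes 0 to the score of [x] and [n] to
    that of [z]. *)
Lemma borda_score_strictly_dominated (x z : C) :
  0 < n -> x != z -> prefers P x z = 0 -> borda_score x P < borda_score z P.
Proof.
move=> n_gt0 neq_xz Nxz; rewrite !borda_score_prefers.
rewrite (bigD1 x) //= [ltnRHS](bigD1 x) //= prefersxx -addSn leq_add //.
  by have := prefers_swap neq_xz; rewrite Nxz add0n => ->.
apply: leq_sum => w _.
by rewrite (leq_trans (prefers_triangle z x w)) // Nxz.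
Qed.

(** A positive denominator is cleared. If it is 0, the quotient is [+oo] and both sides are false,
    the right one by strict domination, which uses [0 < n]. *)
Lemma borda_quotient_le (x z : C) (k : nat) : 0 < n -> z != x ->
  (borda_quotient P x z <= k%:R%:E)%E =
  (borda_score z P <= borda_score x P + k * prefers P x z).
Proof.
move=> n_gt0 neq_zx; rewrite /borda_quotient; case: eqP => [Nxz|/eqP Nxz].
  rewrite Nxz muln0 addn0 [RHS]leqNgt borda_score_strictly_dominated //.
  by rewrite eq_sym.
rewrite lee_fin ler_pdivrMr ?ltr0n ?lt0n //.
by rewrite lerBlDl -natrM -natrD ler_nat.
Qed.

End Prefers.

Section Extension.
Variables (X : finType) (n k : nat) (P : profile X n).

Lemma extends_prefers (Y : finType) (P' : profile (X + Y)%type n) (a b : X) :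
  extends P' P -> prefers P' (inl a) (inl b) = prefers P a b.
Proof.
move=> ext; rewrite !prefersE !big_tuple; apply: eq_bigr => i _.
(* [extends] equates the reflexive relations, so [above] is first written as the negated reverse
   comparison. *)
by rewrite !aboveN -(ext i b a).
Qed.

Lemma extends_borda_score (Y : finType) (P' : profile (X + Y)%type n) (a : X) :
  extends P' P ->
  borda_score (inl a) P' = borda_score a P + \sum_j prefers P' (inl a) (inr j).
Proof.
move=> ext; rewrite !borda_score_prefers big_sumType /=; congr (_ + _).
by apply: eq_bigr => b _; apply: extends_prefers.
Qed.

End Extension.

Section InsertBelow.
Variables (X : finType) (xs : X) (k : nat).

(** The new candidates form one block in index order. As [V xs xs] holds, the block lies directly
    below [xs]. *)
Definition insert_below_rel (V : vote X) : rel (X + 'I_k) := fun u w =>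
  match u, w with
  | inl a, inl b => V a b
  | inl a, inr _ => V a xs
  | inr _, inl b => ~~ V b xs
  | inr i, inr j => i <= j
  end.

Lemma insert_below_linear (V : vote X) :
  [/\ reflexive (insert_below_rel V), antisymmetric (insert_below_rel V),
      transitive (insert_below_rel V) & total (insert_below_rel V)].
Proof.
split.
- by case=> [a|i] /=; [apply: vote_refl | apply: leqnn].
- case=> [a|i] [b|j] //=.
  + by move=> Vab; rewrite (vote_anti Vab).
  + by case: (V a xs).
  + by case: (V b xs).
  + by rewrite -eqn_leq => /eqP/ord_inj->.
- case=> [b|j] [a|i] [c|l] //=.
  + exact: vote_trans.
  + exact: vote_trans.
  + by move=> Vbxs Vbc; apply: contra Vbxs; apply: vote_trans.
  + by move/negPf->.
  (* Here [a] is above the block and [c] below it; [xs] separates them. *)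
  + move=> Vaxs Vcxs; case/orP: (@vote_total _ V a c) => // Vca.
    by rewrite (vote_trans Vca Vaxs) in Vcxs.
  + exact: leq_trans.
- case=> [a|i] [b|j] /=.
  + exact: vote_total.
  + exact: orbN.
  + exact: orNb.
  + exact: leq_total.
Qed.

Definition insert_below (V : vote X) : vote (X + 'I_k)%type :=
  Vote (insert_below_linear V).

Variables (n : nat) (P : profile X n).

Definition insert_below_profile : profile (X + 'I_k)%type n :=
  map_tuple insert_below P.

Lemma insert_below_extends : extends insert_below_profile P.
Proof. by move=> i a b; rewrite /= tnth_map. Qed.

Lemma prefers_insert_below_new (i : 'I_k) :
  prefers insert_below_profile (inr i) (inl xs) = 0.
Proof.
by rewrite prefersE big_map big1 // => V _; rewrite aboveN /= vote_refl.
Qed.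

(** An old candidate is above the block exactly when [V z xs], which for [z != xs] is the strict
    comparison. *)
Lemma prefers_insert_below_old (z : X) (i : 'I_k) : z != xs ->
  prefers insert_below_profile (inl z) (inr i) = prefers P z xs.
Proof.
move=> neq_z; rewrite !prefersE big_map; apply: eq_bigr => V _.
by rewrite aboveN /= negbK /above /= neq_z.
Qed.

End InsertBelow.

Lemma possible_cowinner_bordaP (X : finType) (n k : nat) (P : profile X n)
    (xs : X) :
  possible_cowinner borda P xs k <->
  forall z, z != xs ->
    borda_score z P <= borda_score xs P + k * prefers P xs z.
Proof.
split=> [[P' [ext]] | le_score].
  rewrite inE => /forallP cowin z _; have := cowin (inl z).
  rewrite !(extends_borda_score _ ext) // => le_score.
  (* With the points of [z] against new candidates added on both sides, the claim splits into one
     triangle inequality through [z] per new candidate. *)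
  rewrite -(leq_add2r (\sum_j prefers P' (inl z) (inr j))).
  rewrite (leq_trans le_score) // -addnA leq_add2l.
  rewrite -[k in k * _]card_ord -sum_nat_const -big_split /=.
  apply: leq_sum => j _; rewrite -(extends_prefers _ _ ext).
  exact: prefers_triangle.
pose P' := insert_below_profile xs k P.
have ext : extends P' P by apply: insert_below_extends.
exists P'; split=> //; rewrite inE; apply/forallP=> -[z|i]; last first.
  by apply: borda_score_dominated; apply: prefers_insert_below_new.
have [->|neq_z] := eqVneq z xs; first exact: leqnn.
rewrite !(extends_borda_score _ ext) //.
apply: leq_trans (leq_add (le_score z neq_z) (leqnn _)) _.
rewrite -addnA leq_add2l -[k in k * _]card_ord -sum_nat_const -big_split /=.
(* Both sides equal [n]: the left is the two opposite counts for [xs] and [z], the right holds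
   because [xs] is above the new candidate in every vote. *)
apply: leq_sum => i _; rewrite prefers_insert_below_old //.
rewrite prefers_swap; last by rewrite eq_sym.
have := @prefers_swap _ _ P' (inl xs) (inr i) isT.
by rewrite prefers_insert_below_new addn0 => ->.
Qed.

Theorem proposition8 (X : finType) (xs : X) (hX : 1 < #|X|)
    (n : nat) (hn : 1 <= n) (P : profile X n) (k : nat) (hk : 1 <= k) :
  possible_cowinner borda P xs k <->
  (\big[maxe/-oo]_(z : X | z != xs) borda_quotient P xs z <= k%:R%:E)%E.
Proof.
rewrite possible_cowinner_bordaP; split=> [le_score | /bigmax_leP[_ le_quot] z neq_z].
  (* The maximum starts from [-oo], so this value must be bounded too. *)
  apply/bigmax_leP; split=> [|z neq_z]; first exact: leNye.
  by rewrite borda_quotient_le // le_score.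
by rewrite -borda_quotient_le // le_quot.
Qed.
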